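(* Let $\mathcal T$ be a set of tile designs, with $t_{\mathrm{id}}$ tiles, for the disdyakis dodecahedron with symmetry group the full octahedral group $O_h$ (order $48$). Then the number of ways of tiling the faces of the disdyakis dodecahedron up to full octahedral symmetry $O_h$ is $$\frac{1}{48}\left(t_{\mathrm{id}}^{48}+6t_{\mathrm{id}}^{12}+3t_{\mathrm{id}}^{24}+8t_{\mathrm{id}}^{16}+6t_{\mathrm{id}}^{24}+t_{\mathrm{id}}^{24}+6t_{\mathrm{id}}^{12}+3t_{\mathrm{id}}^{24}+8t_{\mathrm{id}}^8+6t_{\mathrm{id}}^{24}\right)$$ $$=\frac{1}{48}\left(t_{\mathrm{id}}^{48}+19t_{\mathrm{id}}^{24}+8t_{\mathrm{id}}^{16}+12t_{\mathrm{id}}^{12}+8t_{\mathrm{id}}^8\right).$$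
   Context: Tilings. Let $P$ be a polyhedron with set of faces $\mathcal F$ and let $\mathcal A$ be a group of isometries of $P$, acting on $\mathcal F$. A set of tile designs is a finite set $\mathcal T$ together with a group action of $\mathcal A$ on $\mathcal T\times\mathcal F$ lying over the action on $\mathcal F$ (so $A\cdot(T,F)=(T',A\cdot F)$ for some $T'\in\mathcal T$); write $t_{\mathrm{id}}=|\mathcal T|$. A tiling is a map $\tau:\mathcal F\to\mathcal T$; $\mathcal A$ acts on tilings by moving graphs: $A\cdot\tau$ is the tiling with $((A\cdot\tau)(A\cdot F),A\cdot F)=A\cdot(\tau(F),F)$ for all $F$. The number of ways of tiling up to $\mathcal A$ is the number of $\mathcal A$-orbits on the set of tilings. Polyhedron and group. Here $\mathcal A=O_h$ is the group of order $48$ of all $3\times3$ signed permutation matrices. The disdyakis dodecahedron (the Catalan solid dual to the truncated cuboctahedron) is the convex hull of the $O_h$-orbits of $(1,0,0)$, $\alpha(1,1,1)$ and $\beta(1,1,0)$, where $\alpha=(3-\sqrt2)/3$ and $\beta=(10-\sqrt2)/14$ ($6+8+12=26$ vertices, $48$ scalene triangular faces). The group of symmetries of a face induced by its stabilizer in $O_h$ is trivial. *)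

(* Defs.v *)
From HB Require Import structures.
From mathcomp Require Import all_boot all_order all_algebra perm.
From mathcomp Require Import finmap.
From mathcomp Require Import boolp classical_sets functions cardinality.
From mathcomp Require Import reals convex.

Set Implicit Arguments.
Unset Strict Implicit.
Unset Printing Implicit Defensive.

Import Order.TTheory GRing.Theory Num.Theory.

Local Open Scope classical_set_scope.
Local Open Scope ring_scope.

(* Points of R^3 are column vectors, on which matrices act on the left. *)

Definition convex_hull (R : realType) (V : set 'cV[R]_3) : set 'cV[R]_3 :=
  smallest (@convex_set R 'cV[R]_3) V.

Definition affine_dim (R : realType) (F : set 'cV[R]_3) (k : nat) : Prop :=
  exists (p : 'cV[R]_3) (B : 'M[R]_(3, k)),
    [/\ F p,
        forall j : 'I_k, F (p + col j B),
        \rank B = k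
      & forall q, F q -> exists c : 'cV[R]_k, q = p + B *m c].

(* The two-dimensional faces of P; a linear form a, x |-> a *m x, is given by
   a row vector. *)
Definition faces (R : realType) (P : set 'cV[R]_3) : set (set 'cV[R]_3) :=
  [set F | exists (a : 'rV[R]_3) (b : R),
     [/\ forall x, P x -> (a *m x) 0 0 <= b,
         F = [set x | P x /\ (a *m x) 0 0 = b]
       & affine_dim F 2]].

(* G is meant to be a group of matrices mapping P onto itself; the values of
   [tile_act] outside G are irrelevant. *)
Record tile_designs (R : realType) (P : set 'cV[R]_3) (G : set 'M[R]_3)
    (T : finType) := TileDesigns {
  tile_act : 'M[R]_3 -> T * faces P -> T * faces P;
  tile_act1 : forall x, tile_act 1%:M x = x;
  tile_actM : forall A B, G A -> G B ->
    forall x, tile_act (A *m B) x = tile_act A (tile_act B x);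
  tile_act_over : forall A, G A ->
    forall x, val (tile_act A x).2 = mulmx A @` val x.2 }.

Definition tiling_graph (R : realType) (P : set 'cV[R]_3) (T : finType)
    (tau : faces P -> T) : set (T * faces P) :=
  range (fun F => (tau F, F)).

Definition tiling_orbit (R : realType) (P : set 'cV[R]_3) (G : set 'M[R]_3)
    (T : finType) (D : tile_designs P G T) (tau : faces P -> T) :
    set (faces P -> T) :=
  [set tau' | exists2 A, G A &
     tiling_graph tau' = tile_act D A @` tiling_graph tau].

Definition tilings_up_to (R : realType) (P : set 'cV[R]_3) (G : set 'M[R]_3)
    (T : finType) (D : tile_designs P G T) : set (set (faces P -> T)) :=
  range (tiling_orbit D).

(* The signed permutation matrices. *)
Definition Oh (R : realType) : set 'M[R]_3 :=
  [set A | exists (e : 'I_3 -> bool) (s : 'S_3),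
     A = diag_mx (\row_i (-1) ^+ e i) *m perm_mx s].
Arguments Oh : clear implicits.

Definition point (R : realType) (x y z : R) : 'cV[R]_3 :=
  \col_i [:: x; y; z]`_i.

Definition Oh_orbit (R : realType) (v : 'cV[R]_3) : set 'cV[R]_3 :=
  [set A *m v | A in Oh R].

Definition disdyakis_dodecahedron (R : realType) : set 'cV[R]_3 :=
  let alpha := (3 - Num.sqrt 2) / 3 : R in
  let beta := (10 - Num.sqrt 2) / 14 : R in
  convex_hull (Oh_orbit (point 1 0 0)
           `|` Oh_orbit (alpha *: point 1 1 1)
           `|` Oh_orbit (beta *: point 1 1 0)).
Arguments disdyakis_dodecahedron : clear implicits.

(* Main.v *)
Require Import Defs.
From HB Require Import structures.
From mathcomp Require Import all_boot all_order all_algebra perm.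
From mathcomp Require Import fingroup action cyclic zify ring lra.
From mathcomp Require Import finmap.
From mathcomp Require Import boolp classical_sets functions cardinality.
From mathcomp Require Import reals convex interval_inference.

Set Implicit Arguments.
Unset Strict Implicit.
Unset Printing Implicit Defensive.

Import Order.TTheory GRing.Theory Num.Theory.

(** The group of signed permutation matrices acts freely and transitively on
    the 48 faces of the disdyakis dodecahedron.  So, after a base face is
    chosen, a face is the same thing as a group element; and the action on
    pairs (tile, face) can be trivialised by carrying each pair back to the
    base face.  In these coordinates a tiling is a function f from the group
    to T, and the group acts by translation of the argument, whatever the
    action on the tiles was ([card_tilings]).

    Burnside's lemma then counts the orbits.  A function fixed by translation
    by v is a function on the right cosets of the cyclic group of v, so there
    are #|T| ^ (48 / #[v]) of them ([Burnside_translation]), and only the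
    number of group elements of each order matters: a signed permutation
    (e, s) has, as its #[s]-th power, the diagonal matrix whose i-th entry is
    the product of the signs at i, s i, ..., s ^ (#[s] - 1) i, so its order is
    #[s] if these products are all 1, and twice that otherwise.  This gives
    1, 19, 8, 12, 8 elements of orders 1, 2, 3, 4, 6
    ([sum_order_signed_perm]).

    It remains to find the faces.  Among the images of a point under the
    group, the linear form n = (7, 3 + sqrt 2, 2 sqrt 2 - 1) is largest at the
    image x with x_0 >= x_1 >= x_2 >= 0, by the rearrangement inequality, as
    the coefficients of n are decreasing and positive
    ([dominant_facet_max], [exists_dominant]).  The form n takes the value 7
    at one vertex of each of the three kinds; these three vertices generate
    the cone of such x.  So n <= 7 on the polyhedron and n = 7 cuts out a
    triangle.  Conversely let a x = b define a face and let c be the centroid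
    of three affinely independent points of it.  Move c into the cone by some
    group element w: as a combination of the three vertices there, c
    satisfies b = a c <= b (n w c) / 7 ([dominant_bound]), so n w c >= 7.
    Since n w <= 7 on the polyhedron, n w is 7 at all three points, and the
    face lies in the plane n w = 7 ([faces_facet]).  The action on the faces
    is free because the coefficients of n are positive and distinct
    ([facet_inj]). *)

(** * Functions on a group up to translation *)

Section Translation.
Local Open Scope group_scope.

Definition translate (W : finGroupType) (T : finType) (f : {ffun W -> T})
  (v : W) : {ffun W -> T} := [ffun w => f (v * w)%g].

Lemma translate_is_action (W : finGroupType) (T : finType) :
  is_action [set: W] (@translate W T).
Proof.
split=> [v f g /ffunP fg | f u v _ _].
  by apply/ffunP => w; have := fg (v^-1 * w)%g; rewrite !ffunE mulKVg.
by apply/ffunP => w; rewrite !ffunE mulgA.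
Qed.

Definition translation (W : finGroupType) (T : finType) :=
  Action (translate_is_action W T).

(** A function is fixed by translation by v exactly when it factors through
    the right cosets of the cyclic group of v. *)
Lemma card_fix_translation (W : finGroupType) (T : finType) (v : W) :
  #|'Fix_([set: {ffun W -> T}] | translation W T)[v]| =
  (#|T| ^ (#|W| %/ #[v]%g))%N.
Proof.
pose cosets := rcosets <[v]> [set: W].
have mem_cosets w : <[v]> :* w \in cosets by rewrite -rcosetE imset_f ?inE.
pose coset_at w : {C | C \in cosets} := exist _ (<[v]> :* w) (mem_cosets w).
pose lift (g : {ffun {C | C \in cosets} -> T}) := [ffun w => g (coset_at w)].
have lift_inj : injective lift.
  move=> g g' /ffunP eqg; apply/ffunP => -[C Cc].
  have [w _ defC] := rcosetsP Cc; have := eqg w; rewrite !ffunE.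
  by congr (g _ = g' _); apply: val_inj; rewrite /= defC.
rewrite finset.setTI.
have -> : afix (translation W T) [set v] = lift @: [set: _].
  apply/setP => f; apply/afix1P/imsetP => [fixf | [g _ ->]].
    exists [ffun C => f (repr (val C))]; rewrite ?inE//.
    apply/ffunP => w; rewrite !ffunE /=.
    have /rcosetP[_ /cycleP[n ->] ->] := mem_repr_rcoset <[v]>%G w.
    elim: n => [|n IHn]; first by rewrite expg0 mul1g.
    by rewrite IHn -[in LHS]fixf ffunE expgS mulgA.
  apply/ffunP => w; rewrite !ffunE; congr (g _); apply: val_inj => /=.
  by rewrite rcosetM rcoset_id ?cycle_id.
rewrite card_imset // cardsT card_ffun card_sig; congr (_ ^ _)%N.
rewrite -[RHS]/(_ %/ #|<[v]>|)%N -cardsT.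
by rewrite (@divgS _ [set: W]%G <[v]>%G (finset.subsetT _)).
Qed.

Lemma Burnside_translation (W : finGroupType) (T : finType) :
  (#|orbit (translation W T) [set: W] @: [set: {ffun W -> T}]| * #|W|)%N =
  \sum_(v : W) (#|T| ^ (#|W| %/ #[v]%g))%N.
Proof.
have acts_all : [acts [set: W], on [set: {ffun W -> T}] | translation W T].
  apply/fintype.subsetP => v _; rewrite !inE.
  by apply/fintype.subsetP => f; rewrite !inE.
rewrite -(cardsT W) -(Frobenius_Cauchy (G := [set: W]%G) acts_all).
apply: eq_big => [v | v _]; first by rewrite inE.
by rewrite card_fix_translation cardsT.
Qed.

End Translation.

(** * The group of signed permutations *)

Section SignedPermutations.
Local Open Scope group_scope.

(** The pair (e, s) stands for the matrix diag ((-1) ^ e i) * perm_mx s, which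
    maps a point x to the point with coordinates (-1) ^ e i * x (s i); the group
    law below is matrix multiplication.  A new name for the product type keeps
    this law apart from the direct product. *)
Definition signed_perm := ({ffun 'I_3 -> bool} * 'S_3)%type.
HB.instance Definition _ := Finite.on signed_perm.

Definition sp_one : signed_perm := ([ffun=> false], 1).
Definition sp_mul (v w : signed_perm) : signed_perm :=
  ([ffun i => v.1 i (+) w.1 (v.2 i)], v.2 * w.2).
Definition sp_inv (w : signed_perm) : signed_perm :=
  ([ffun i => w.1 (w.2^-1 i)], w.2^-1).

Lemma sp_mulA : associative sp_mul.
Proof.
move=> u v w; congr pair; last exact: mulgA.
by apply/ffunP => i; rewrite !ffunE permM addbA.
Qed.

Lemma sp_mul1 : left_id sp_one sp_mul.
Proof.
move=> [e s]; congr pair; last exact: mul1g.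
by apply/ffunP => i; rewrite !ffunE perm1.
Qed.

Lemma sp_mulV : left_inverse sp_one sp_inv sp_mul.
Proof.
move=> [e s]; congr pair; last exact: mulVg.
by apply/ffunP => i; rewrite !ffunE addbb.
Qed.

HB.instance Definition _ :=
  Finite_isGroup.Build signed_perm sp_mulA sp_mul1 sp_mulV.

Lemma sp_mulE (v w : signed_perm) :
  v * w = ([ffun i => v.1 i (+) w.1 (v.2 i)], v.2 * w.2).
Proof. by []. Qed.

Lemma sp_expE (w : signed_perm) n :
  w ^+ n = ([ffun i => \big[addb/false]_(k < n) w.1 ((w.2 ^+ k) i)],
            w.2 ^+ n) :> signed_perm.
Proof.
elim: n => [|n IHn].
  rewrite !expg0; congr pair; apply/ffunP => i.
  by rewrite !ffunE big_ord0.
rewrite expgS IHn sp_mulE -expgS; congr pair; apply/ffunP => i.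
rewrite !ffunE big_ord_recl expg0 perm1; congr addb.
by apply: eq_bigr => k _; rewrite expgS permM.
Qed.

(** The order is a multiple of #[w.2], and w ^+ #[w.2] is a pure sign change,
    of order 1 or 2. *)
Lemma order_signed_perm (w : signed_perm) :
  #[w] = (#[w.2] * (w ^+ #[w.2] != 1%g).+1)%N.
Proof.
have dvd2 : #[w.2] %| #[w].
  have /(congr1 snd) := expg_order w; rewrite sp_expE /= => w2.
  by rewrite order_dvdn w2.
case: eqVneq => [w1 | neq1] /=.
  by apply/eqP; rewrite muln1 eqn_dvd dvd2 andbT order_dvdn w1.
have dvd_double : #[w] %| #[w.2] * 2.
  rewrite order_dvdn expgM (sp_expE w) expg_order expgS expg1 sp_mulE /= mulg1.
  apply/eqP; congr pair; apply/ffunP => i.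
  by rewrite !ffunE perm1 addbb.
have [k defk] := dvdnP dvd2; move: dvd_double neq1.
rewrite defk mulnC dvdn_pmul2l ?order_gt0 // => /[dup] /dvdn_leq.
case: k defk => [|[|[|k]]] // defk _ _.
by rewrite -{1}[#[w.2]]mul1n -defk expg_order eqxx.
Qed.

End SignedPermutations.

(** * Orders of signed permutations *)

Section Orders.
Local Open Scope ring_scope.

Definition signs3 (a b c : bool) : {ffun 'I_3 -> bool} :=
  [ffun i : 'I_3 => [:: a; b; c]`_i].

Lemma ord3_cases (i : 'I_3) : [\/ i = 0, i = 1 | i = 2%:R].
Proof.
case: i => [[|[|[|//]]] ?]; [apply: Or31 | apply: Or32 | apply: Or33];
  exact: val_inj.
Qed.

Lemma perm3P (s u : 'S_3) :
  s 0 = u 0 -> s 1 = u 1 -> s 2%:R = u 2%:R -> s = u.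
Proof. by move=> *; apply/permP => i; case: (ord3_cases i) => ->. Qed.

Lemma tperm3E (a b i : 'I_3) :
  tperm a b i = if i == a then b else if i == b then a else i.
Proof. by rewrite permE. Qed.

Local Notation t01 := (tperm (0 : 'I_3) 1).
Local Notation t02 := (tperm (0 : 'I_3) 2%:R).
Local Notation t12 := (tperm (1 : 'I_3) 2%:R).

Definition perms3 : seq 'S_3 :=
  [:: 1%g; t01; t02; t12; (t01 * t02)%g; (t02 * t01)%g].

Lemma mem_perms3 (s : 'S_3) : s \in perms3.
Proof.
have n01 : s 0 != s 1 by rewrite (inj_eq perm_inj).
have n02 : s 0 != s 2%:R by rewrite (inj_eq perm_inj).
have n12 : s 1 != s 2%:R by rewrite (inj_eq perm_inj).
suff: has (fun u : 'S_3 => [&& s 0 == u 0, s 1 == u 1 & s 2%:R == u 2%:R])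
    perms3.
  case/hasP => u u_in /and3P[/eqP s0 /eqP s1 /eqP s2].
  by rewrite (perm3P s0 s1 s2).
rewrite /= !permM !perm1 !tperm3E.
case: (ord3_cases (s 0)) n01 n02 n12 => ->;
by case: (ord3_cases (s 1)) => -> //; case: (ord3_cases (s 2%:R)) => -> //.
Qed.

Lemma big_perms3 (F : 'S_3 -> nat) :
  (\sum_s F s = \sum_(s <- perms3) F s)%N.
Proof.
rewrite -big_enum; apply/perm_big/uniq_perm; rewrite ?enum_uniq //.
  apply: (leq_size_uniq (enum_uniq 'S_3)) => [s _ | ]; first exact: mem_perms3.
  by rewrite -cardE card_Sn.
by move=> s; rewrite mem_perms3 mem_enum.
Qed.

Lemma big_signs3 (F : {ffun 'I_3 -> bool} -> nat) :
  (\sum_e F e =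
   \sum_(a : bool) \sum_(b : bool) \sum_(c : bool) F (signs3 a b c))%N.
Proof.
rewrite pair_bigA pair_bigA /=.
rewrite (reindex (fun x : bool * bool * bool => signs3 x.1.1 x.1.2 x.2)) //.
exists (fun e : {ffun 'I_3 -> bool} => (e 0, e 1, e 2%:R))
  => [[[a b] c] _ | e _] /=.
  by rewrite !ffunE.
by apply/ffunP => i; rewrite ffunE; case: (ord3_cases i) => ->.
Qed.

Lemma sp_exp_neq1 (e : {ffun 'I_3 -> bool}) (s : 'S_3) :
  (((e, s) : signed_perm) ^+ #[s] != 1)%g =
  [exists i, \big[addb/false]_(k < #[s]%g) e ((s ^+ k)%g i)].
Proof.
apply/idP/existsP => [|[i Ni]]; last first.
  apply: contraTneq Ni; rewrite sp_expE => -[/ffunP/(_ i)].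
  by rewrite !ffunE => ->.
move=> neq1; apply/existsP; apply: contraR neq1 => /existsPn noN; apply/eqP.
rewrite sp_expE /= expg_order; congr pair.
by apply/ffunP => i; rewrite !ffunE; apply: negbTE.
Qed.

Lemma exists3 (P : pred 'I_3) : [exists i, P i] = [|| P 0, P 1 | P 2%:R].
Proof.
apply/existsP/or3P => [[i] | [] Pi]; try by eexists; apply: Pi.
by case: (ord3_cases i) => ->; [apply: Or31 | apply: Or32 | apply: Or33].
Qed.

(** The existential is the condition under which (e, s) has order 2 #[s]
    ([order_signed_perm], [sp_exp_neq1]); once it is computed as a function of
    the three signs, the sum over e is explicit. *)
Lemma sum_sign_twists (F : nat -> nat) (s : 'S_3) n
    (twist : bool -> bool -> bool -> bool) :
    #[s]%g = n ->
    (forall e : {ffun 'I_3 -> bool},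
       [exists i, \big[addb/false]_(k < n) e ((s ^+ k)%g i)] =
       twist (e 0) (e 1) (e 2%:R)) ->
  (\sum_(e : {ffun 'I_3 -> bool})
     F (#[s]%g *
        [exists i, \big[addb/false]_(k < #[s]%g) e ((s ^+ k)%g i)].+1) =
   \sum_(a : bool) \sum_(b : bool) \sum_(c : bool)
     F (n * (twist a b c).+1))%N.
Proof.
move=> -> twistE; under eq_bigr do rewrite twistE.
rewrite big_signs3; do 3![apply: eq_bigr => ? _].
by rewrite !ffunE.
Qed.

(** Among the 8 sign changes e, the order of (e, s) exceeds that of s for 7
    when s = 1, for the 4 with different signs on the swapped indices when s
    is one of the 3 transpositions, and for the 4 with an odd number of minus
    signs when s is one of the 2 three-cycles. *)
Lemma sum_order_signed_perm (F : nat -> nat) :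
  (\sum_(w : signed_perm) F #[w]%g =
   F 1 + 19 * F 2 + 8 * F 3 + 12 * F 4 + 8 * F 6)%N.
Proof.
transitivity (\sum_(s : 'S_3) \sum_(e : {ffun 'I_3 -> bool})
    F (#[s]%g *
       [exists i, \big[addb/false]_(k < #[s]%g) e ((s ^+ k)%g i)].+1))%N.
  rewrite exchange_big pair_bigA; apply: eq_bigr => -[e s] _.
  by rewrite order_signed_perm sp_exp_neq1.
have order2 i j : i != j -> #[tperm i j : 'S_3]%g = 2%N.
  move=> ij; apply: nt_prime_order => //; first by rewrite expgS expg1 tperm2.
  by apply: contraNneq ij => /permP/(_ i); rewrite tpermL perm1 => ->.
have order3 (s : 'S_3) : s \in [:: t01 * t02; t02 * t01]%g -> #[s]%g = 3%N.
  rewrite !inE => /pred2P[] ->; apply: nt_prime_order => //;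
    try by apply: perm3P; rewrite !expgS expg0 !permM !tperm3E !perm1.
  - by apply/eqP => /permP/(_ 0); rewrite permM !tperm3E perm1.
  - by apply/eqP => /permP/(_ 0); rewrite permM !tperm3E perm1.
rewrite big_perms3 !big_cons big_nil /=.
rewrite (@sum_sign_twists F 1%g _ (fun a b c => [|| a, b | c])
  (order1 _)); last first.
  by move=> e; rewrite exists3 !big_ord_recl !big_ord0 expg0 !perm1 !addbF.
rewrite (@sum_sign_twists F t01 _ (fun a b c => a (+) b)
  (order2 _ _ _)) //; last first.
  move=> e; rewrite exists3 !big_ord_recl !big_ord0 /= expg0 expg1.
  rewrite !perm1 !tperm3E /=.
  by do 3 case: (e _).
rewrite (@sum_sign_twists F t02 _ (fun a b c => a (+) c)
  (order2 _ _ _)) //; last first.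
  move=> e; rewrite exists3 !big_ord_recl !big_ord0 /= expg0 expg1.
  rewrite !perm1 !tperm3E /=.
  by do 3 case: (e _).
rewrite (@sum_sign_twists F t12 _ (fun a b c => b (+) c)
  (order2 _ _ _)) //; last first.
  move=> e; rewrite exists3 !big_ord_recl !big_ord0 /= expg0 expg1.
  rewrite !perm1 !tperm3E /=.
  by do 3 case: (e _).
rewrite (@sum_sign_twists F (t01 * t02)%g _ (fun a b c => a (+) b (+) c)
  (order3 _ _)) //; last 2 first.
- by rewrite !inE eqxx.
- move=> e; rewrite exists3 !big_ord_recl !big_ord0 /= !expgS expg0 !permM.
  rewrite !perm1 !tperm3E /=.
  by do 3 case: (e _).
rewrite (@sum_sign_twists F (t02 * t01)%g _ (fun a b c => a (+) b (+) c)
  (order3 _ _)) //; last 2 first.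
- by rewrite !inE eqxx orbT.
- move=> e; rewrite exists3 !big_ord_recl !big_ord0 /= !expgS expg0 !permM.
  rewrite !perm1 !tperm3E /=.
  by do 3 case: (e _).
rewrite !big_bool /=.
rewrite !mul1n !muln1 -[(2 * 2)%N]/4%N -[(3 * 2)%N]/6%N.
lia.
Qed.

End Orders.

Local Open Scope classical_set_scope.
Local Open Scope ring_scope.

(** * The faces of the disdyakis dodecahedron *)

Section Faces.
Context (R : realType).
Implicit Types (v w : signed_perm) (x y : 'cV[R]_3) (a : 'rV[R]_3).

Definition sp_mx w : 'M[R]_3 :=
  diag_mx (\row_i (-1) ^+ w.1 i) *m perm_mx w.2.

Lemma sp_mxE w x i : (sp_mx w *m x) i 0 = (-1) ^+ w.1 i * x (w.2 i) 0.
Proof. by rewrite -mulmxA -row_permE mul_diag_mx !mxE. Qed.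

Lemma sp_mx1 : sp_mx 1%g = 1%:M.
Proof.
apply/row_matrixP => i; apply/rowP => j.
rewrite !mxE (bigD1 i) //= big1 => [|k ki]; rewrite !mxE ?ffunE ?perm1 ?eqxx.
  by rewrite expr0 mul1r addr0.
by rewrite eq_sym (negbTE ki) mul0r.
Qed.

Lemma sp_mxM v w : sp_mx (v * w)%g = sp_mx v *m sp_mx w.
Proof.
apply/matrixP => i j.
have sp_mx_mxE (u : signed_perm) (A : 'M[R]_3) k :
    (sp_mx u *m A) k j = (-1) ^+ u.1 k * A (u.2 k) j.
  by rewrite -mulmxA -row_permE mul_diag_mx !mxE.
rewrite -[sp_mx (v * w)%g]mulmx1 -[sp_mx w]mulmx1 !sp_mx_mxE sp_mulE /= ffunE.
by rewrite permM signr_addb mulrA.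
Qed.

Lemma sp_mxK w :
  cancel (mulmx (sp_mx w)) (mulmx (sp_mx w^-1%g) : 'cV_3 -> 'cV_3).
Proof. by move=> x; rewrite mulmxA -sp_mxM mulVg sp_mx1 mul1mx. Qed.

Lemma sp_mxVK w :
  cancel (mulmx (sp_mx w^-1%g)) (mulmx (sp_mx w) : 'cV_3 -> 'cV_3).
Proof. by move=> x; rewrite mulmxA -sp_mxM mulgV sp_mx1 mul1mx. Qed.

Lemma OhE : Oh R = range sp_mx.
Proof.
apply/seteqP; split=> [A [e [s ->]] | _ [[e s] _ <-]]; last by exists e, s.
exists (finfun e, s) => //; congr (diag_mx _ *m _).
by apply/rowP => i; rewrite !mxE ffunE.
Qed.

Lemma dot3E a x :
  (a *m x) 0 0 = a 0 0 * x 0 0 + a 0 1 * x 1 0 + a 0 2%:R * x 2%:R 0.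
Proof.
rewrite mxE !big_ord_recl big_ord0 addr0 addrA.
by congr (_ * _ + _ * _ + _ * _); congr (_ _ _); apply: val_inj.
Qed.

Lemma colP3 x y :
  x 0 0 = y 0 0 -> x 1 0 = y 1 0 -> x 2%:R 0 = y 2%:R 0 -> x = y.
Proof. by move=> *; apply/colP => i; case: (ord3_cases i) => ->. Qed.

Lemma convex_halfspace a b :
  @convex_set R 'cV[R]_3 [set x | (a *m x) 0 0 <= b].
Proof.
move=> x y l.
rewrite !inE /= => ax ay.
have -> : conv l x y = l%:num *: (x : 'cV_3) + (1 - l%:num) *: (y : 'cV_3).
  by [].
have l0 : 0 <= l%:num by [].
have l1 : 0 <= 1 - l%:num by rewrite subr_ge0.
rewrite mulmxDr -!scalemxAr mxE [X in X + _]mxE [X in _ + X]mxE.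
by have := ler_wpM2l l0 ax; have := ler_wpM2l l1 ay; lra.
Qed.

Lemma convex_preimage (M : 'M[R]_3) (X : set 'cV[R]_3) :
  @convex_set R 'cV[R]_3 X -> @convex_set R 'cV[R]_3 [set x | X (M *m x)].
Proof.
move=> cX x y l; rewrite !inE /= => Xx Xy.
have := cX (M *m x) (M *m y) l; rewrite !inE => /(_ Xx Xy).
by rewrite /conv /= mulmxDr -!scalemxAr.
Qed.

Lemma convex_hull_convex (V : set 'cV[R]_3) :
  @convex_set R 'cV[R]_3 (convex_hull V).
Proof.
move=> x y l; rewrite !inE /= => Vx Vy X [cX VX].
by have := cX x y l; rewrite !inE; apply; [apply: Vx|apply: Vy].
Qed.

Local Notation r := (Num.sqrt 2 : R).
Local Notation alpha := ((3 - r) / 3 : R).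
Local Notation beta := ((10 - r) / 14 : R).
Local Notation P := (disdyakis_dodecahedron R).

Lemma sqr_sqrt2 : r ^+ 2 = 2.
Proof. by rewrite sqr_sqrtr. Qed.

Lemma beta_scale : (10 + r) * beta = 7.
Proof. by have := sqr_sqrt2; lra. Qed.

Lemma alpha_scale : (9 + 3 * r) * alpha = 7.
Proof. by have := sqr_sqrt2; lra. Qed.

Lemma sqrt2_gt1 : 1 < r.
Proof. by rewrite -[ltLHS]sqrtr1 ltr_sqrt ?ltr1n. Qed.

Lemma sqrt2_lt2 : r < 2.
Proof.
by rewrite ltNge; apply/negP => r2; have := sqr_sqrt2; nra.
Qed.

(** The form is scaled to be 7 on the base vertices: the reciprocals of alpha
    and beta are (9 + 3 sqrt 2) / 7 and (10 + sqrt 2) / 7. *)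
Definition facet_normal : 'rV[R]_3 := \row_j [:: 7; 3 + r; 2 * r - 1]`_j.

Lemma facet_normalE x :
  (facet_normal *m x) 0 0 =
  7 * x 0 0 + (3 + r) * x 1 0 + (2 * r - 1) * x 2%:R 0.
Proof. by rewrite dot3E !mxE. Qed.

Definition base_vertex (i : 'I_3) : 'cV[R]_3 :=
  [:: Defs.point 1 0 0; beta *: Defs.point 1 1 0; alpha *: Defs.point 1 1 1]`_i.

Lemma base_vertexE i j :
  base_vertex i j 0 =
  nth 0 (nth [::] [:: [:: 1; 0; 0]; [:: beta; beta; 0];
                      [:: alpha; alpha; alpha]] i) j.
Proof.
by case: (ord3_cases i) => ->; case: (ord3_cases j) => ->;
  rewrite /base_vertex /= ?mxE /= ?mulr1 ?mulr0.
Qed.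

(** A fundamental domain of the signed permutations: a Weyl chamber of type
    B_3, spanned by the base vertices. *)
Definition dominant x :=
  [/\ 0 <= x 2%:R 0, x 2%:R 0 <= x 1 0 & x 1 0 <= x 0 0].

Lemma dominant_base_vertex i : dominant (base_vertex i).
Proof.
have := sqrt2_lt2; have := sqrt2_gt1.
by case: (ord3_cases i) => ->; rewrite /dominant !base_vertexE /= => ? ?;
  split; lra.
Qed.

Lemma facet_normal_base_vertex i : (facet_normal *m base_vertex i) 0 0 = 7.
Proof.
have := sqr_sqrt2.
by case: (ord3_cases i) => ->; rewrite facet_normalE !base_vertexE /= => ?; lra.
Qed.

(** The rearrangement inequality for the decreasing positive coefficients
    7 > 3 + sqrt 2 > 2 sqrt 2 - 1. *)
Lemma dominant_facet_max w x : dominant x ->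
  (facet_normal *m (sp_mx w *m x)) 0 0 <= (facet_normal *m x) 0 0.
Proof.
case=> x2 x21 x10; rewrite !facet_normalE !sp_mxE.
have := sqrt2_gt1; have := sqrt2_lt2 => r2 r1.
have signP (b : bool) (t : R) : 0 <= t -> (-1) ^+ b * t <= t.
  by case: b => t0; rewrite ?expr1 ?expr0; lra.
have x_ge0 i : 0 <= x i 0 by case: (ord3_cases i) => ->; lra.
apply: (@le_trans _ _ (7 * x (w.2 0) 0 + (3 + r) * x (w.2 1) 0 +
                       (2 * r - 1) * x (w.2 2%:R) 0)).
  by rewrite !lerD // ler_wpM2l ?signP //; lra.
(* The coefficients of facet_normal decrease by 4 - r at each step. *)
have diff01 : 0 <= (4 - r) * (x 0 0 - x 1 0) by apply: mulr_ge0; lra.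
have diff12 : 0 <= (4 - r) * (x 1 0 - x 2%:R 0) by apply: mulr_ge0; lra.
have := mem_perms3 w.2; rewrite !inE.
move=> /predU1P[-> | /predU1P[-> | /predU1P[-> | /predU1P[-> | /pred2P[] ->]]]];
by rewrite ?permM ?perm1 ?tperm3E /=; lra.
Qed.

Lemma base_vertex_in w i : P (sp_mx w *m base_vertex i).
Proof.
apply: sub_gen_smallest; have Ohw : Oh R (sp_mx w) by rewrite OhE; exists w.
by case: (ord3_cases i) => ->; [left; left | right | left; right];
  exists (sp_mx w).
Qed.

Lemma polyhedron_sub_convex (Q : set 'cV[R]_3) : @convex_set R 'cV[R]_3 Q ->
  (forall w i, Q (sp_mx w *m base_vertex i)) -> P `<=` Q.
Proof.
move=> cQ Qv; apply: smallest_sub => // x; rewrite /Oh_orbit OhE.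
by case=> [[]|] [_ [w _ <-] <-];
  [apply: (Qv w 0) | apply: (Qv w 2%:R) | apply: (Qv w 1)].
Qed.

Lemma polyhedron_facet_bound x : P x -> (facet_normal *m x) 0 0 <= 7.
Proof.
apply: (polyhedron_sub_convex (@convex_halfspace facet_normal 7)).
move=> w i /=; rewrite -(facet_normal_base_vertex i).
by apply: dominant_facet_max; exact: dominant_base_vertex.
Qed.

Lemma polyhedron_invariant w x : P x -> P (sp_mx w *m x).
Proof.
apply: (@polyhedron_sub_convex [set y | P (sp_mx w *m y)]).
  by apply: convex_preimage; exact: convex_hull_convex.
by move=> v i /=; rewrite mulmxA -sp_mxM; exact: base_vertex_in.
Qed.

(** Take the image of x on which facet_normal is largest: a swap of adjacent
    coordinates, or a change of sign of the last one, cannot increase it. *)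
Lemma exists_dominant x : exists w, dominant (sp_mx w *m x).
Proof.
pose h (w : signed_perm) : R := (facet_normal *m (sp_mx w *m x)) 0 0.
have [w wmax] : exists w, forall v, h v <= h w.
  have [w _ wmax] :=
    @Order.TotalTheory.arg_maxP _ _ _ (1%g : signed_perm) xpredT h isT.
  by exists w => v; exact: (wmax v isT).
exists w; set y := sp_mx w *m x.
have {wmax} ymax v :
    (facet_normal *m (sp_mx v *m y)) 0 0 <= (facet_normal *m y) 0 0.
  by have := wmax (v * w)%g; rewrite /h sp_mxM -(mulmxA (sp_mx v)).
clearbody y; clear h w x.
have := sqrt2_gt1; have := sqrt2_lt2 => r2 r1.
split.
- have := ymax (signs3 false false true, 1%g).
  rewrite !facet_normalE !sp_mxE !ffunE !perm1 /= !expr0 expr1.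
  have [// | y2] := leP 0 (y 2%:R 0).
  have : 0 < (2 * r - 1) * - y 2%:R 0 by apply: mulr_gt0; lra.
  by lra.
- have := ymax ([ffun=> false], tperm (1 : 'I_3) 2%:R).
  rewrite !facet_normalE !sp_mxE !ffunE !tperm3E /= !expr0.
  have [// | y2] := leP (y 2%:R 0) (y 1 0).
  have : 0 < (4 - r) * (y 2%:R 0 - y 1 0) by apply: mulr_gt0; lra.
  by lra.
- have := ymax ([ffun=> false], tperm (0 : 'I_3) 1).
  rewrite !facet_normalE !sp_mxE !ffunE !tperm3E /= !expr0.
  have [// | y2] := leP (y 1 0) (y 0 0).
  have : 0 < (4 - r) * (y 1 0 - y 0 0) by apply: mulr_gt0; lra.
  by lra.
Qed.

(** A dominant x is a combination of the base vertices with nonnegative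
    coefficients, whose sum is a seventh of the value of facet_normal at x. *)
Lemma dominant_bound a b x : dominant x ->
    (forall i, (a *m base_vertex i) 0 0 <= b) ->
  7 * (a *m x) 0 0 <= b * (facet_normal *m x) 0 0.
Proof.
have := sqrt2_gt1; have := sqrt2_lt2 => r2 r1.
case=> x2 x21 x10 ab; have := ab 0; have := ab 1; have := ab 2%:R.
rewrite facet_normalE !dot3E !base_vertexE /= => a2 a1 a0.
(* The bounds at the base vertices, with alpha and beta cleared; they are then
   weighted by multiples of the coefficients of x in the base vertices. *)
have {}a1 : 7 * (a 0 0 + a 0 1) <= (10 + r) * b.
  have -> : 7 * (a 0 0 + a 0 1) =
      (10 + r) * (a 0 0 * beta + a 0 1 * beta + a 0 2%:R * 0).
    by rewrite -[X in X * _ = _]beta_scale; field.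
  by rewrite ler_wpM2l //; lra.
have {}a2 : 7 * (a 0 0 + a 0 1 + a 0 2%:R) <= (9 + 3 * r) * b.
  have -> : 7 * (a 0 0 + a 0 1 + a 0 2%:R) =
      (9 + 3 * r) * (a 0 0 * alpha + a 0 1 * alpha + a 0 2%:R * alpha).
    by rewrite -[X in X * _ = _]alpha_scale; field.
  by rewrite ler_wpM2l //; lra.
have {}a0 : 0 <= (x 0 0 - x 1 0) * (b - a 0 0) by apply: mulr_ge0; lra.
have {}a1 : 0 <= (x 1 0 - x 2%:R 0) * ((10 + r) * b - 7 * (a 0 0 + a 0 1)).
  by apply: mulr_ge0; lra.
have {}a2 : 0 <= x 2%:R 0 * ((9 + 3 * r) * b - 7 * (a 0 0 + a 0 1 + a 0 2%:R)).
  by apply: mulr_ge0; lra.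
by lra.
Qed.

(** The inverse makes this the image under w of the base face
    ([image_facet]). *)
Definition facet w : set 'cV[R]_3 :=
  [set x | P x /\ (facet_normal *m sp_mx w^-1%g *m x) 0 0 = 7].

Lemma image_facet v w : mulmx (sp_mx v) @` facet w = facet (v * w)%g.
Proof.
have E (x : 'cV_3) : facet_normal *m sp_mx (v * w)^-1%g *m x =
    facet_normal *m sp_mx w^-1%g *m (sp_mx v^-1%g *m x).
  by rewrite invMg sp_mxM !mulmxA.
apply/seteqP; split=> [_ [x [Px x7] <-] | x [Px x7]].
  by split; [exact: polyhedron_invariant | rewrite E sp_mxK].
exists (sp_mx v^-1%g *m x); last exact: sp_mxVK.
by split; [exact: polyhedron_invariant | rewrite -E].
Qed.

Lemma base_vertex_facet w i : facet w (sp_mx w *m base_vertex i).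
Proof.
split; first exact: base_vertex_in.
by rewrite -mulmxA sp_mxK facet_normal_base_vertex.
Qed.

Lemma facet_bound w x : P x -> (facet_normal *m sp_mx w *m x) 0 0 <= 7.
Proof.
move=> Px; rewrite -mulmxA polyhedron_facet_bound //.
exact: polyhedron_invariant.
Qed.

Lemma dot_base_vertices a :
  (forall i, (a *m base_vertex i) 0 0 = 7) -> a = facet_normal.
Proof.
move=> a7; have := a7 0; have := a7 1; have := a7 2%:R.
rewrite !dot3E !base_vertexE /= => a2 a1 a0.
have {}a0 : a 0 0 = 7 by lra.
have {}a1 : a 0 1 = 3 + r.
  have : (10 + r) * beta * (a 0 0 + a 0 1) = (10 + r) * 7 by rewrite -a1; field.
  by rewrite beta_scale a0; lra.
have {}a2 : a 0 2%:R = 2 * r - 1.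
  have : (9 + 3 * r) * alpha * (a 0 0 + a 0 1 + a 0 2%:R) = (9 + 3 * r) * 7.
    by rewrite -a2; field.
  by rewrite alpha_scale a0 a1; lra.
by apply/rowP => j; rewrite mxE; case: (ord3_cases j) => ->.
Qed.

Lemma facet_normal_gt0 i : 0 < facet_normal 0 i.
Proof.
by have := sqrt2_gt1; rewrite mxE; case: (ord3_cases i) => -> /= ?; lra.
Qed.

Lemma facet_normal_inj : injective (facet_normal 0).
Proof.
have := sqrt2_lt2; have := sqrt2_gt1 => r1 r2 i j; rewrite !mxE.
by case: (ord3_cases i) => ->; case: (ord3_cases j) => -> //= ?; exfalso; lra.
Qed.

(** A signed permutation of the coordinates moves a vector with positive and
    distinct coordinates. *)
Lemma facet_normal_stabilizer w :
  facet_normal *m sp_mx w = facet_normal -> w = 1%g.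
Proof.
case: w => e s fixn.
have nE i : facet_normal 0 (s i) = (-1) ^+ e i * facet_normal 0 i.
  rewrite -{1}fixn /sp_mx mulmxA /= -[s]invgK -col_permE mxE invgK permK.
  by rewrite mul_mx_diag !mxE mulrC.
have e0 i : e i = false.
  have := facet_normal_gt0 (s i); rewrite nE; case: (e i) => //.
  by rewrite expr1 mulN1r oppr_gt0 ltNge ltW // facet_normal_gt0.
congr pair; first by apply/ffunP => i; rewrite e0 ffunE.
apply/permP => i; rewrite perm1; apply: facet_normal_inj.
by rewrite nE e0 expr0 mul1r.
Qed.

(** The face of v contains the images under v of the three base vertices,
    which determine its plane. *)
Lemma facet_inj : injective facet.
Proof.
move=> v w vw; suff /facet_normal_stabilizer wv1 :
    facet_normal *m sp_mx (w^-1 * v)%g = facet_normal.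
  by rewrite -[v](mulKVg w) wv1 mulg1.
apply: dot_base_vertices => i.
by have [_ <-] : facet w (sp_mx v *m base_vertex i);
  [rewrite -vw; exact: base_vertex_facet | rewrite sp_mxM !mulmxA].
Qed.

Lemma facet1_affine_dim : affine_dim (facet 1%g) 2.
Proof.
(* The columns of B are edge vectors of the face; C is a left inverse of B. *)
pose B : 'M[R]_(3, 2) :=
  \matrix_(i, j) (base_vertex (lift ord0 j) i 0 - base_vertex 0 i 0).
pose C : 'M[R]_(2, 3) := \matrix_(i, j)
  nth 0 (nth [::] [:: [:: 0; (10 + r) / 7; - ((10 + r) / 7)];
                      [:: 0; 0; (9 + 3 * r) / 7]] i) j.
have vF i : facet 1%g (base_vertex i).
  by have := base_vertex_facet 1%g i; rewrite sp_mx1 mul1mx.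
have rB := sqr_sqrt2.
have CE i (x : 'cV_3) : (C *m x) i 0 =
   nth 0 [:: (10 + r) / 7 * (x 1 0 - x 2%:R 0); (9 + 3 * r) / 7 * x 2%:R 0] i.
  have -> : (C *m x) i 0 = (row i C *m x) 0 0 by rewrite -row_mul [RHS]mxE.
  by rewrite dot3E !mxE; case: i => [[|[|//]] ?] /=; lra.
exists (base_vertex 0), B; split=> // [j | | q [_]].
- rewrite (_ : _ + _ = base_vertex (lift ord0 j)) //.
  by apply/colP => i; rewrite !mxE addrC subrK.
- apply/eqP; rewrite eqn_leq rank_leq_col /=.
  suff CB : C *m B = 1%:M.
    by rewrite -[X in (X <= _)%N](mxrank1 R 2) -CB mxrankM_maxr.
  apply/matrixP => i j.
  have -> : (C *m B) i j = (C *m col j B) i 0.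
    by rewrite !mxE; apply: eq_bigr => k _; rewrite [col _ _ _ _]mxE.
  rewrite CE ![col _ _ _ _]mxE ![B _ _]mxE !base_vertexE mxE.
  by case: i => [[|[|//]] ?]; case: j => [[|[|//]] ?] /=; lra.
rewrite invg1 sp_mx1 mulmx1 facet_normalE => q7.
exists (C *m q).
have BE i : (base_vertex 0 + B *m (C *m q)) i 0 =
    base_vertex 0 i 0 +
    (base_vertex 1 i 0 * ((10 + r) / 7 * (q 1 0 - q 2%:R 0)) -
     base_vertex 0 i 0 * ((10 + r) / 7 * (q 1 0 - q 2%:R 0)) +
     (base_vertex 2%:R i 0 * ((9 + 3 * r) / 7 * q 2%:R 0) -
      base_vertex 0 i 0 * ((9 + 3 * r) / 7 * q 2%:R 0))).
  rewrite -!mulrBl mxE [X in _ + X]mxE !big_ord_recl big_ord0 addr0 !CE /=.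
  by rewrite ![B _ _]mxE;
    congr (_ + ((base_vertex _ _ _ - _) * _ + (base_vertex _ _ _ - _) * _));
    apply: val_inj.
have b1 t : beta * ((10 + r) / 7 * t) = t.
  transitivity ((10 + r) * beta * t / 7); first by field.
  by rewrite beta_scale; field.
have b2 t : alpha * ((9 + 3 * r) / 7 * t) = t.
  transitivity ((9 + 3 * r) * alpha * t / 7); first by field.
  by rewrite alpha_scale; field.
apply: colP3; rewrite BE !base_vertexE /=.
all: by rewrite ?b1 ?b2; lra.
Qed.

Lemma mulmx_col a m (B : 'M[R]_(3, m)) j : (a *m col j B) 0 0 = (a *m B) 0 j.
Proof. by rewrite !mxE; apply: eq_bigr => k _; rewrite [col _ _ _ _]mxE. Qed.

Lemma signed_axis_in (b : bool) i : P ((-1) ^+ b *: delta_mx i 0).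
Proof.
have -> : (-1) ^+ b *: delta_mx i 0 =
    sp_mx ([ffun=> b], tperm (0 : 'I_3) i) *m base_vertex 0.
  have v0 j : base_vertex 0 j 0 = (j == 0)%:R.
    by rewrite base_vertexE; case: (ord3_cases j) => ->.
  apply/colP => j; rewrite sp_mxE v0 /= ffunE !mxE eqxx andbT.
  by rewrite -{2}[0](tpermR (0 : 'I_3) i) (inj_eq perm_inj).
exact: base_vertex_in.
Qed.

Lemma form_axisE a (b : bool) i :
  (a *m ((-1) ^+ b *: delta_mx i 0 : 'cV[R]_3)) 0 0 = (-1) ^+ b * a 0 i.
Proof. by rewrite -scalemxAr -colE !mxE. Qed.

Lemma supporting_level_gt0 a b :
  (forall x, P x -> (a *m x) 0 0 <= b) -> a != 0 -> 0 < b.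
Proof.
move=> aP; rewrite ltNge; apply: contraNN => b0; apply/eqP/rowP => i.
have := aP _ (signed_axis_in true i); have := aP _ (signed_axis_in false i).
by rewrite !form_axisE expr1 expr0 mxE; lra.
Qed.

(** A nonzero form that kills the directions of a plane is constant on the
    plane, but it cannot be constant on the vertices e_i and - e_i of P. *)
Lemma polyhedron_not_planar p (B : 'M[R]_(3, 2)) :
  ~ (forall x, P x -> exists c : 'cV_2, x = p + B *m c).
Proof.
move=> planar; set u := nz_row (kermx B).
have uB : u *m B = 0 by apply/sub_kermxP; exact: nz_row_sub.
have uP x : P x -> (u *m x) 0 0 = (u *m p) 0 0.
  by case/planar => c ->; rewrite mulmxDr mulmxA uB mul0mx addr0.
have : u != 0.
  rewrite nz_row_eq0 -mxrank_eq0 mxrank_ker subn_eq0 -ltnNge ltnS.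
  exact: rank_leq_col.
case/eqP; apply/rowP => i; rewrite mxE.
have := uP _ (signed_axis_in true i); rewrite -(uP _ (signed_axis_in false i)).
by rewrite !form_axisE expr1 expr0; lra.
Qed.

Lemma annihilator_line a n (B : 'M[R]_(3, 2)) :
  \rank B = 2%N -> a *m B = 0 -> n *m B = 0 -> n != 0 -> exists k, a = k *: n.
Proof.
move=> rB aB nB n_neq0.
have nK : (n <= kermx B)%MS by apply/sub_kermxP.
apply/sub_rVP/(submx_trans (_ : (a <= kermx B)%MS)); first exact/sub_kermxP.
by rewrite -(geq_leqif (mxrank_leqif_sup nK)) mxrank_ker rB rank_rV n_neq0.
Qed.

(** The centroid c of three affinely independent points of the face tells
    which facet it is: that of w^-1, if w makes c dominant.  Its form is at
    least 7 at c and at most 7 on P, hence 7 at the three points, and it is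
    proportional to the form that defines the face. *)
Lemma faces_facet F : faces P F -> exists w, F = facet w.
Proof.
move=> [a [b [aP FE [p [B [Fp FB rB qF]]]]]].
have [Pp ap] : P p /\ (a *m p) 0 0 = b by move: Fp; rewrite FE.
have aB : a *m B = 0.
  apply/rowP => j; rewrite -mulmx_col [RHS]mxE.
  by have := FB j; rewrite FE => -[_]; rewrite mulmxDr mxE ap; lra.
have b_gt0 : 0 < b.
  apply: (supporting_level_gt0 aP); apply/eqP => a0.
  apply: (@polyhedron_not_planar p B) => x Px; apply: qF; rewrite FE.
  by split=> //; rewrite -ap a0 !mul0mx.
pose c := p + 3^-1 *: (col 0 B + col 1 B).
have cE (u : 'rV[R]_3) : (u *m c) 0 0 =
    (u *m p) 0 0 + 3^-1 * ((u *m B) 0 0 + (u *m B) 0 1).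
  rewrite mulmxDr -scalemxAr mulmxDr mxE [X in _ + X]mxE [X in _ * X]mxE.
  by rewrite !mulmx_col.
have ac : (a *m c) 0 0 = b by rewrite cE ap aB !mxE; lra.
have [w dom] := exists_dominant c.
set n := facet_normal *m sp_mx w.
have nc_ge7 : 7 <= (n *m c) 0 0.
  have bound i : (a *m sp_mx w^-1%g *m base_vertex i) 0 0 <= b.
    by rewrite -mulmxA; apply: aP; exact: base_vertex_in.
  have := dominant_bound dom bound; rewrite -mulmxA sp_mxK ac mulrC.
  by rewrite ler_pM2l // mulmxA.
(* The mean of three values that are at most 7 is at least 7. *)
have np : (n *m p) 0 0 <= 7 by exact: facet_bound.
have nj j : (n *m p) 0 0 + (n *m B) 0 j <= 7.
  have : P (p + col j B) by have := FB j; rewrite FE => -[].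
  by move/(facet_bound w); rewrite mulmxDr mxE mulmx_col.
have np7 : (n *m p) 0 0 = 7.
  by have := nj 0; have := nj 1; move: nc_ge7; rewrite cE; lra.
have nB : n *m B = 0.
  apply/rowP => j; rewrite [RHS]mxE; have := nj 0; have := nj 1; move: nc_ge7.
  rewrite cE; have : j = 0 \/ j = 1.
    by case: j => [[|[|//]] ?]; [left | right]; exact: val_inj.
  by case=> ->; lra.
have [|k ak] := annihilator_line rB aB nB.
  by apply/eqP => n0; move: np7; rewrite n0 mul0mx mxE; lra.
have axk (x : 'cV_3) : (a *m x) 0 0 = k * (n *m x) 0 0.
  by rewrite ak -scalemxAl mxE.
have bk : b = k * 7 by rewrite -ap axk np7.
exists w^-1%g; rewrite FE /facet invgK; apply/seteqP.
split=> x /= [Px]; rewrite axk bk => xb; split=> //; last by rewrite xb.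
by apply: mulfI xb; apply/eqP => k0; move: b_gt0; rewrite bk k0; lra.
Qed.

Lemma facet_face w : faces P (facet w).
Proof.
exists (facet_normal *m sp_mx w^-1%g), 7; split => //.
  by move=> x Px; exact: facet_bound.
have [p [B [Fp FB rB qF]]] := facet1_affine_dim.
rewrite -[w]mulg1 -image_facet; exists (sp_mx w *m p), (sp_mx w *m B); split.
- by exists p.
- move=> j; exists (p + col j B) => //; rewrite mulmxDr; congr (_ + _).
  by rewrite !colE mulmxA.
- have uw : sp_mx w \in unitmx.
    have /mulmx1_unit[] // : sp_mx w *m sp_mx w^-1%g = 1%:M.
    by rewrite -sp_mxM mulgV sp_mx1.
  by rewrite (eqmxMfull B (_ : row_full (sp_mx w))) // row_full_unit.
- move=> _ [q Fq <-]; have [c ->] := qF q Fq.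
  by exists c; rewrite mulmxDr mulmxA.
Qed.

End Faces.

(** * Tilings of a polyhedron with a free and transitive group *)

Lemma card_fset_set_image (X : finType) (Y : choiceType) (f : X -> Y)
    (A : {set X}) :
  injective f -> #|` fset_set (f @` [set` A]) | = #|A|.
Proof.
move=> f_inj; rewrite fset_set_image // card_imfset //=.
have -> : [set` A] = [set` [fset x in A]%fset] :> set X.
  by apply/seteqP; split=> x /=; rewrite !inE.
by rewrite set_fsetK card_imfset //= -cardE.
Qed.

Section Transfer.
Context (R : realType) (P : set 'cV[R]_3) (W : finGroupType) (T : finType).
Context (M : W -> 'M[R]_3) (facet : W -> set 'cV[R]_3).
Context (M1 : M 1%g = 1%:M).
Context (MM : forall v w, M (v * w)%g = M v *m M w).
Context (facet_inj : injective facet).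
Context (facet_face : forall w, faces P (facet w)).
Context (face_facet : forall F, faces P F -> exists w, F = facet w).
Context (image_facet : forall v w, mulmx (M v) @` facet w = facet (v * w)%g).
Context (D : tile_designs P (range M) T).

Let face_at w : faces P := exist _ (facet w) (mem_set (facet_face w)).
Let act w := tile_act D (M w).

Let act1 x : act 1%g x = x. Proof. by rewrite /act M1 tile_act1. Qed.
Let actM v w x : act (v * w)%g x = act v (act w x).
Proof. by rewrite /act MM tile_actM. Qed.
Let act_over v t w : (act v (t, face_at w)).2 = face_at (v * w)%g.
Proof.
apply: val_inj; rewrite /= -image_facet.
exact: tile_act_over.
Qed.
Let act_inj w : injective (act w).
Proof.
by apply: (can_inj (g := act w^-1%g)) => x; rewrite -actM mulVg act1.
Qed.

(** Carrying every tile back to the base face trivialises the action on tiles,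
    whatever that action is. *)
Let encode (tau : faces P -> T) : {ffun W -> T} :=
  [ffun w => (act w^-1%g (tau (face_at w), face_at w)).1].

Let encodeP tau w :
  act w (encode tau w, face_at 1%g) = (tau (face_at w), face_at w).
Proof.
rewrite ffunE -[RHS]act1 -[X in _ = act X _](mulgV w) actM; congr (act w _).
by rewrite [RHS]surjective_pairing act_over mulVg.
Qed.

Let face_atP F : exists w, F = face_at w.
Proof.
have [w Fw] := face_facet (set_mem (valP F)).
by exists w; apply: val_inj; rewrite /= -Fw.
Qed.

Let encode_surj f : exists tau, encode tau = f.
Proof.
have [coord coordP] := choice face_atP.
have coordK w : coord (face_at w) = w.
  by apply: facet_inj; have /(congr1 val) := coordP (face_at w).
pose tau F := (act (coord F) (f (coord F), face_at 1%g)).1.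
exists tau; apply/ffunP => w.
have : act w (encode tau w, face_at 1%g) = act w (f w, face_at 1%g).
  by rewrite encodeP [RHS]surjective_pairing act_over mulg1 /tau coordK.
by move/act_inj => -[].
Qed.

(** Moving a tiling by M v turns its code f into f (v^-1 _): carrying back
    from the face of v w by v w undoes the move by v and carries back by w. *)
Let tiling_orbitP tau :
  tiling_orbit D tau =
  encode @^-1` [set` orbit (translation W T) [set: W]%SET (encode tau)].
Proof.
have shiftP v tau' : tiling_graph tau' = act v @` tiling_graph tau <->
    encode tau = translate (encode tau') v.
  split=> [graphE | encE].
    apply/ffunP => w; rewrite [RHS]ffunE.
    have : tiling_graph tau' (act v (tau (face_at w), face_at w)).
      rewrite graphE; exists (tau (face_at w), face_at w) => //.
      by exists (face_at w).
    case=> F _ actE; have FE : F = face_at (v * w)%g.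
      by rewrite -(act_over v (tau (face_at w))) -actE.
    by move: actE; rewrite FE -!encodeP actM => /act_inj/act_inj[->].
  have actE w : act v (tau (face_at w), face_at w) =
      (tau' (face_at (v * w)%g), face_at (v * w)%g).
    by rewrite -!encodeP encE [translate _ _ _]ffunE actM.
  apply/seteqP; split=> [_ [F _ <-] | _ [_ [F _ <-] <-]].
    have [w ->] := face_atP F.
    exists (tau (face_at (v^-1 * w)%g), face_at (v^-1 * w)%g).
      by exists (face_at (v^-1 * w)%g).
    by rewrite actE mulKVg.
  by have [w ->] := face_atP F; rewrite actE; exists (face_at (v * w)%g).
apply/seteqP; split=> [tau' [_ [v _ <-] /shiftP encE] | tau' /=].
  by rewrite /= orbit_sym; apply/orbitP; exists v; rewrite ?inE // encE.
rewrite orbit_sym => /orbitP[v _ encE]; exists (M v); first by exists v.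
exact/shiftP.
Qed.

(** By [tiling_orbitP] the orbits of tilings are the preimages of the orbits
    of translation under the encoding, which is surjective. *)
Lemma card_tilings :
  finite_set (tilings_up_to D) /\
  #|` fset_set (tilings_up_to D) | =
  #|(orbit (translation W T) [set: W] @: [set: {ffun W -> T}])%SET|.
Proof.
pose preim_enc (O : {set {ffun W -> T}}) : set (faces P -> T) :=
  encode @^-1` [set` O].
set orbits := (_ @: _)%SET.
have -> : tilings_up_to D = preim_enc @` [set` orbits].
  apply/seteqP; split=> [_ [tau _ <-] | _ [O /= /imsetP[f _ ->] <-]].
    rewrite tiling_orbitP; eexists; last reflexivity.
    by rewrite /= imset_f ?inE.
  by have [tau <-] := encode_surj f; exists tau; rewrite // tiling_orbitP.
split; first exact: finite_image.
apply: card_fset_set_image => O O' eqO; apply/setP => f.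
have [tau <-] := encode_surj f; apply/idP/idP => Otau.
  by have : preim_enc O' tau by rewrite -eqO.
by have : preim_enc O tau by rewrite eqO.
Qed.

End Transfer.

(** * The number of tilings *)

Theorem theorem10 (R : realType) (T : finType)
    (D : tile_designs (disdyakis_dodecahedron R) (Oh R) T) :
  let t : rat := #|T|%:R in
  [/\ finite_set (tilings_up_to D),
      #|` fset_set (tilings_up_to D) |%:R =
        1 / 48 * (t ^+ 48 + 6 * t ^+ 12 + 3 * t ^+ 24 + 8 * t ^+ 16
                  + 6 * t ^+ 24 + t ^+ 24 + 6 * t ^+ 12 + 3 * t ^+ 24
                  + 8 * t ^+ 8 + 6 * t ^+ 24)
    & 1 / 48 * (t ^+ 48 + 6 * t ^+ 12 + 3 * t ^+ 24 + 8 * t ^+ 16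
                + 6 * t ^+ 24 + t ^+ 24 + 6 * t ^+ 12 + 3 * t ^+ 24
                + 8 * t ^+ 8 + 6 * t ^+ 24) =
      1 / 48 * (t ^+ 48 + 19 * t ^+ 24 + 8 * t ^+ 16 + 12 * t ^+ 12
                + 8 * t ^+ 8)].
Proof.
move=> t.
move: D; rewrite OhE => D.
have [fin ->] := card_tilings (@sp_mx1 R) (@sp_mxM R) (@facet_inj R)
  (@facet_face R) (@faces_facet R) (@image_facet R) D.
split=> //; last by ring.
have := Burnside_translation signed_perm T.
have -> : #|{: signed_perm}| = 48.
  by rewrite -sum1_card (sum_order_signed_perm (fun=> 1%N)).
rewrite (sum_order_signed_perm (fun k => #|T| ^ (48 %/ k))%N).
set N := #|_|.
have tX k : t ^+ k = (#|T| ^ k)%:R by rewrite natrX.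
rewrite -[(48 %/ 1)%N]/48%N -[(48 %/ 2)%N]/24%N -[(48 %/ 3)%N]/16%N.
rewrite -[(48 %/ 4)%N]/12%N -[(48 %/ 6)%N]/8%N !tX.
move: (#|T| ^ 48)%N (#|T| ^ 24)%N (#|T| ^ 16)%N (#|T| ^ 12)%N (#|T| ^ 8)%N.
move=> a b c d e /(congr1 (fun n => n%:R : rat)) E.
have {}E :
    N%:R * 48 = a%:R + 19 * b%:R + 8 * c%:R + 12 * d%:R + 8 * e%:R :> rat.
  transitivity ((N * 48)%N%:R : rat); first by ring.
  rewrite E; ring.
by lra.
Qed.
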